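(* Let $2\le k\le n$. The M\''obius function $\mu$ of the lattice $\Lambda_k^n$ at $\pi=(F_1,\dots,F_\ell)\in\Lambda_k^n$, with the blocks enumerated so that $|F_1|\ge\dots\ge|F_\ell|$, is $$\mu(\pi,\hat{\mathbf{1}}_n)=\begin{cases}1, & \text{if }\pi=\hat{\mathbf{1}}_n,\\ 0, & \text{if }|F_2|\geq2,\\ (-1)^{k-|F_1|}\binom{n-|F_1|-1}{n-k}, & \text{if }|F_2|=1\text{ and }k-1\geq|F_1|\geq2,\\ (-1)^k\left[\binom{n-1}{n-k}-n\binom{n-2}{n-k}\right], & \text{if }\pi=\hat{\mathbf{0}}_n.\end{cases}$$
   Context: $\Pi_n$ denotes the set of all partitions of $\{1,\dots,n\}$ into nonempty disjoint blocks, ordered by refinement: $\pi\le\sigma$ iff every block of $\pi$ is contained in a block of $\sigma$. $\hat{\mathbf{0}}_n$ is the partition into singletons and $\hat{\mathbf{1}}_n$ the one-block partition. The shape $\operatorname{sh}(\pi)$ of $\pi\in\Pi_n$ is the integer partition of $n$ listing the block sizes in decreasing order. Integer partitions of $n$ are ordered by: $\alpha\preceq\beta$ iff the indices of the parts of $\alpha$ can be partitioned into blocks $(G_1,\dots,G_{\ell(\beta)})$, where $\ell(\beta)$ is the number of parts of $\beta$, with $\sum_{j\in G_i}\alpha_j=\beta_i$ for all $i$. For $2\le k\le n$, $$\Lambda_k^n:=\{\pi\in\Pi_n:\ \pi=\hat{\mathbf{1}}_n\ \text{ or }\ \operatorname{sh}(\pi)\preceq(k-1,1^{n-k+1})\},$$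 where $1^r$ means the part $1$ repeated $r$ times. $\Lambda_k^n$ carries the order induced from $\Pi_n$, and its M\''obius function is: $\mu(x,x)=1$, $\mu(x,y)=-\sum_{z\in\Lambda_k^n,\,x\le z<y}\mu(x,z)$ for $x<y$, and $\mu(x,y)=0$ otherwise. *)

(* Defs.v *)
From HB Require Import structures.
From mathcomp Require Import all_boot all_order all_algebra.

Set Implicit Arguments.
Unset Strict Implicit.
Unset Printing Implicit Defensive.

Import Order.TTheory GRing.Theory.

(* The ground set {1, ..., n} is represented by 'I_n = {0, ..., n - 1}. *)
Record set_partition (n : nat) := SetPartition {
  blocks :> {set {set 'I_n}};
  _ : partition blocks [set: 'I_n]
}.

HB.instance Definition _ n := [isSub for @blocks n].
HB.instance Definition _ n := [Finite of set_partition n by <:].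

Section Refinement.
Variable n : nat.
Implicit Types p q r : set_partition n.

Definition refines p q : bool := [forall B in p, exists C in q, B \subset C].

Lemma refinesP p q :
  reflect (forall B, B \in blocks p -> exists2 C, C \in blocks q & B \subset C)
          (refines p q).
Proof.
apply: (iffP forall_inP) => H B /H; first by case/exists_inP=> C; exists C.
by case=> C qC BC; apply/exists_inP; exists C.
Qed.

Lemma refines_refl : reflexive refines.
Proof. by move=> p; apply/refinesP => B pB; exists B. Qed.

Lemma refines_trans : transitive refines.
Proof.
move=> q p r /refinesP pq /refinesP qr; apply/refinesP => B /pq[C /qr[D rD CD] BC].
by exists D => //; apply: subset_trans CD.
Qed.

Lemma refines_anti : antisymmetric refines.
Proof.
suff sub p q : refines p q -> refines q p -> blocks p \subset blocks q.
  move=> p q /andP[pq qp]; apply: val_inj; apply/eqP.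
  by rewrite eqEsubset !sub.
move=> /refinesP pq /refinesP qp; apply/subsetP => B pB.
have [C qC BC] := pq _ pB; have [D pD CD] := qp _ qC.
case: p pB pD {pq qp} => /= P /and3P[_ /trivIsetP tP nP] pB pD.
have [x Bx] : exists x, x \in B by apply/set0Pn/eqP => B0; rewrite -B0 pB in nP.
have Dx : x \in D by apply: (subsetP CD); apply: (subsetP BC).
have BD : B = D.
  apply/eqP; apply: contraT => /(tP _ _ pB pD) /pred0P/(_ x) /=.
  by rewrite Bx Dx.
suff -> : B = C by [].
by rewrite -BD in CD; apply/eqP; rewrite eqEsubset BC.
Qed.

End Refinement.

Fact refinement_display : Order.disp_t. Proof. exact: Order.Disp tt tt. Qed.

HB.instance Definition _ n :=
  Order.Le_isPOrder.Build refinement_display (set_partition n)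
    (@refines_refl n) (@refines_anti n) (@refines_trans n).

Lemma singletons_partition n :
  partition [set [set i] | i : 'I_n] [set: 'I_n].
Proof.
apply/and3P; split.
- rewrite /cover eqEsubset subsetT; apply/subsetP => x _.
  by apply/bigcupP; exists [set x]; rewrite ?set11 // imset_f.
- apply/trivIsetP => _ _ /imsetP[i _ ->] /imsetP[j _ ->] ij.
  rewrite disjoints1 inE.
  by apply: contraNneq ij => ->.
- by apply/imsetP => -[i _] /setP/(_ i); rewrite !inE eqxx.
Qed.

Definition zero_partition n : set_partition n :=
  SetPartition (singletons_partition n).

(* Removing set0 only matters for n = 0, where the unique partition has no
   block; see [one_partitionE]. *)
Lemma full_partition n : partition ([set [set: 'I_n]] :\ set0) [set: 'I_n].
Proof.
apply/and3P; split; last by rewrite !inE eqxx.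
- rewrite eqEsubset subsetT; apply/subsetP => x _; apply/bigcupP.
  by exists [set: 'I_n]; rewrite ?inE // eqxx andbT; apply/set0Pn; exists x; rewrite inE.
- by apply/trivIsetP => A B; rewrite !inE => /andP[_ /eqP->] /andP[_ /eqP->]; rewrite eqxx.
Qed.

Definition one_partition n : set_partition n := SetPartition (full_partition n).

Lemma one_partitionE n : 0 < n -> blocks (one_partition n) = [set [set: 'I_n]].
Proof.
move=> n_gt0; apply/setP => A; rewrite !inE andb_idl // => /eqP->.
by apply/set0Pn; exists (Ordinal n_gt0); rewrite inE.
Qed.

Definition sh n (p : set_partition n) : seq nat :=
  sort geq [seq #|B| | B : {set 'I_n} in blocks p].

(* The blocks (G_1, ..., G_l(b)) are the fibres of G; they are nonempty as soon
   as the parts of b are positive. *)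
Definition intpart_le (a b : seq nat) : bool :=
  [exists G : {ffun 'I_(size a) -> 'I_(size b)},
    [forall i, \sum_(j | G j == i) nth 0 a j == nth 0 b i]].

Definition Lambda (k n : nat) : {set set_partition n} :=
  [set p | (p == one_partition n)
        || intpart_le (sh p) (k - 1 :: nseq (n - k + 1) 1)].

Section Moebius.
Local Open Scope ring_scope.
Local Open Scope order_scope.
Variables (d : Order.disp_t) (T : finPOrderType d) (L : {set T}).

(* Recursion bounded by m; [moebiusE] shows that #|T|.+1 steps are enough. *)
Fixpoint moebius_rec (m : nat) (x y : T) : int :=
  if m is m'.+1 then
    if x == y then 1
    else if x < y then - (\sum_(z in L | x <= z < y) moebius_rec m' x z)
    else 0
  else 0.

(* Moebius function of the subset L of T with the induced order. *)
Definition moebius (x y : T) : int := moebius_rec #|T|.+1 x y.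

Lemma moebius_rec_stable m1 m2 x y :
  (#|[set z | (z < y)%O]| < m1)%N -> (#|[set z | (z < y)%O]| < m2)%N ->
  moebius_rec m1 x y = moebius_rec m2 x y.
Proof.
elim: m1 m2 y => [|m1 IH] [|m2] y //=; rewrite !ltnS => H1 H2.
case: eqP => // _; case: ifP => // _; congr (- _)%R.
apply: eq_bigr => z /and3P[_ _ zy].
have zyP : (#|[set t | (t < z)%O]| < #|[set t | (t < y)%O]|)%N.
  apply: proper_card; apply/properP; split.
    by apply/subsetP => t; rewrite !inE => /lt_trans; apply.
  by exists z; rewrite !inE ?ltxx.
by apply: IH; apply: leq_trans zyP _.
Qed.

Lemma moebiusE x y :
  moebius x y =
    if x == y then 1
    else if x < y then - (\sum_(z in L | x <= z < y) moebius x z)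
    else 0.
Proof.
rewrite {1}/moebius /=; case: eqP => // _; case: ifP => // _; congr (- _)%R.
apply: eq_bigr => z /and3P[_ _ zy]; apply: moebius_rec_stable.
  rewrite -cardsT; apply: proper_card; apply/properP; split; first exact: subsetT.
  by exists y; rewrite !inE // lt_gtF.
by rewrite ltnS max_card.
Qed.

End Moebius.

(* Main.v *)
Require Import Defs.
From mathcomp Require Import all_boot all_order all_algebra.
From mathcomp Require Import zify ring.
Set Implicit Arguments.
Unset Strict Implicit.
Unset Printing Implicit Defensive.
Import Order.TTheory GRing.Theory.
Local Open Scope ring_scope.

(** The recursion defining the Moebius function fixes its left argument and
    sums over the right one, which is inconvenient here: the set of elements
    above a given partition is the easy one to describe.  Since the Moebius
    function is a two-sided inverse of the zeta function, it may be computed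
    from above: a function g whose sums over the intervals from x to the top
    are 1 for the top and 0 for every other x is x |-> mu(x, 1)
    ([moebius_uniq_above]).

    The candidate g is supported on the top and on the partitions
    [one_block A] having A as a block and singletons elsewhere.  Put the
    weight (-1)^(k - |A|) C(n - |A| - 1, n - k) on every subset A with
    |A| < k, the empty set and the singletons included, push these weights
    forward along A |-> one_block A, and add 1 at the top.  All subsets of
    size at most 1 are sent to the partition into singletons, and this is
    where the two-term value there comes from.

    Let supp p be the union of the blocks of p with at least two elements.
    Then p <= one_block A iff supp p is contained in A ([le_one_block]), so the
    sum of g above p is 1 plus the total weight of the sets A with |A| < k that
    contain supp p.  If p is a member of Lambda other than the top, then
    |supp p| < k ([card_supp_Lambda]), and that total weight is -1 whatever
    supp p is ([sum_weight_supersets]): it is a coefficient of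
    (1 + x)^(M + 1 + r) (1 + x)^-(M + 1) = (1 + x)^r.  Above the top itself
    there are no such A, because the support of the top has n >= k elements.

    The four cases of the theorem are read off by listing the sets A of size
    less than k with one_block A = p: none if p is the top or has two large
    blocks, only the large block if there is exactly one, and all sets of size
    at most 1 if p is the partition into singletons. *)

(** * Computing a Moebius function from above *)

Section MoebiusFromAbove.
Local Open Scope order_scope.
Variables (d : Order.disp_t) (T : finPOrderType d) (L : {set T}).

Lemma moebius_sum_upto (x w : T) : x \in L -> w \in L -> x <= w ->
  (\sum_(z in L | x <= z <= w) moebius L x z) = (x == w)%:R.
Proof.
move=> xL wL xw; rewrite (bigD1 w) /=; last by rewrite wL xw lexx.
rewrite (eq_bigl (fun z => (z \in L) && (x <= z < w))); last first.
  by move=> z; rewrite /= lt_neqAle -!andbA; do !bool_congr.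
rewrite {1}moebiusE; case: eqVneq => [->|neq_xw].
  rewrite big_pred0 ?addr0 // => z.
  by apply/negP => /and3P[_ /le_lt_trans h /h]; rewrite ltxx.
by rewrite lt_neqAle neq_xw xw addNr.
Qed.

(** The sum of mu(x, z) g(w) over x <= z <= w <= y collapses to mu(x, y) when
    summed over w first, and to g x when summed over z first. *)
Lemma moebius_uniq_above (g : T -> int) (y : T) : y \in L ->
    {in L, forall x, x <= y -> (\sum_(z in L | x <= z <= y) g z) = (x == y)%:R} ->
  {in L, forall x, x <= y -> moebius L x y = g x}.
Proof.
move=> yL gP x xL xy.
transitivity (\sum_(z in L | x <= z <= y)
                 \sum_(w in L | (z <= w <= y)%O)
                 moebius L x z * g w).
  rewrite (bigD1 y) /=; last by rewrite yL xy lexx.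
  rewrite -mulr_sumr gP // eqxx mulr1 big1 ?addr0 // => z /andP[/and3P[zL xz zy] ne].
  by rewrite -mulr_sumr gP // (negbTE ne) mulr0.
rewrite (exchange_big_dep [pred w in L | x <= w <= y]) /=; last first.
  by move=> z w /and3P[zL xz zy] /and3P[-> zw ->]; rewrite (le_trans xz zw).
rewrite (bigD1 x) /=; last by rewrite xL lexx xy.
rewrite [X in _ + X = _]big1 ?addr0 => [|w /andP[/and3P[wL xw wy] ne]];
  rewrite -mulr_suml.
- rewrite (eq_bigl (fun z => (z \in L) && (x <= z <= x))) ?moebius_sum_upto //.
    by rewrite eqxx mul1r.
  move=> z; case: (z \in L) => //=; case xz: (x <= z) => //=.
  by rewrite xL xy andbT /=; case zx: (z <= x); rewrite ?andbF // (le_trans zx xy).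
- rewrite (eq_bigl (fun z => (z \in L) && (x <= z <= w))) ?moebius_sum_upto //.
    by rewrite eq_sym (negbTE ne) mul0r.
  move=> z; case: (z \in L) => //=; case xz: (x <= z) => //=.
  by rewrite wL wy andbT /=; case zw: (z <= w); rewrite ?andbF // (le_trans zw wy).
Qed.
End MoebiusFromAbove.

(** * The binomial identity *)

(** Up to the sign (-1)^(r - j), the factor C(M + (r - j), M) is the coefficient
    of x^(r - j) in (1 + x)^-(M + 1), so the sum is the coefficient of x^r in
    (1 + x)^(N - M - 1): it depends on N - M only.  Pascal's rule for
    C(N + 1, j), followed by Pascal's rule for the other factor, cancels one
    factor 1 + x. *)
Lemma alternating_binomial_shift (N M r : nat) :
  \sum_(j < r.+1) (-1) ^+ (r - j) * ('C(N.+1, j) * 'C(M.+1 + (r - j), M.+1))%:R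
  = \sum_(j < r.+1) (-1) ^+ (r - j) * ('C(N, j) * 'C(M + (r - j), M))%:R :> int.
Proof.
rewrite big_ord_recl /= bin0 mul1n.
under eq_bigr => i _ do rewrite /bump leq0n add1n binS mulnDl natrD mulrDr.
rewrite big_split /= addrA.
(* The C(N, j) part, with its term j = 0, is a full sum again; its term j = r is
   C(N, r), because both C(M + 1, M + 1) and C(M, M) are 1. *)
have -> : (-1) ^+ (r - 0) * ('C(M.+1 + (r - 0), M.+1))%:R +
   \sum_(i < r) (-1) ^+ (r - i.+1) * ('C(N, i.+1) * 'C(M.+1 + (r - i.+1), M.+1))%:R
  = \sum_(j < r.+1) (-1) ^+ (r - j) * ('C(N, j) * 'C(M.+1 + (r - j), M.+1))%:R :> int.
  by rewrite big_ord_recl /= bin0 mul1n.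
rewrite big_ord_recr [RHS]big_ord_recr /= addrAC -big_split /= subnn !addn0 !binn.
congr (_ + _); apply: eq_bigr => i _.
have [e re] : exists e, (r - i = e.+1)%N by exists (r - i.+1)%N; have := ltn_ord i; lia.
have -> : (r - i.+1 = e)%N by lia.
rewrite re.
rewrite !addSn !addnS binS exprS !natrM natrD; ring.
Qed.

(** The coefficient of x^r in (1 + x)^r; for M = 0 the sum is, up to sign,
    the expansion of (1 - 1)^(r + 1) = 0 without its last term, which is 1. *)
Lemma alternating_binomial1 (M r : nat) :
  \sum_(j < r.+1) (-1) ^+ (r - j) * ('C(M.+1 + r, j) * 'C(M + (r - j), M))%:R = 1%R :> int.
Proof.
elim: M => [|M IH]; last by rewrite addSn alternating_binomial_shift.
have := exprDn (-1 : int) 1 r.+1; rewrite addrC subrr expr0n /= => /esym.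
rewrite big_ord_recr /= binn subnn mul1r expr1n mulr1n => /eqP.
rewrite addr_eq0 => /eqP sum_eq; apply: (@mulrI _ (-1)); first exact: unitrN1.
rewrite mulr1 -[RHS]sum_eq mulr_sumr; apply: eq_bigr => j _.
have jr : (j <= r)%N by rewrite -ltnS.
by rewrite mulrA -exprS bin0 muln1 expr1n mulr1 mulr_natr subSn.
Qed.

Lemma card_supersets (T : finType) (S : {set T}) (j : nat) :
  #|[set A : {set T} | (S \subset A) && (#|A| == #|S| + j)%N]| = 'C(#|T| - #|S|, j).
Proof.
have -> : (#|T| - #|S| = #|~: S|)%N by rewrite [RHS]cardsCs setCK.
rewrite -cards_draws -[RHS](@card_in_imset _ _ (fun B => S :|: B)).
  apply: eq_card => A; rewrite !inE; apply/andP/imsetP => [[SA cA]|[B]].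
    exists (A :\: S); last by rewrite setUC setDE setUIl (setUidPl SA) setUC setUCr setIT.
    rewrite inE setDE subsetIr /= -setDE cardsD (setIidPr SA).
    by rewrite (eqP cA) addKn.
  rewrite inE => /andP[BS /eqP cB] ->; split; first exact: subsetUl.
  by rewrite cardsU disjoint_setI0 ?cards0 ?subn0 ?cB // disjoint_sym disjoints_subset.
have keep (B : {set T}) : B \subset ~: S -> (S :|: B) :\: S = B.
  by move=> BS; rewrite setDUl setDv set0U; apply/setDidPl; rewrite disjoints_subset.
move=> B C; rewrite !inE => /andP[/keep BS _] /andP[/keep CS _] eqBC.
by rewrite -BS eqBC CS.
Qed.

Definition weight (n k m : nat) : int :=
  ((-1) ^+ (k - m) * 'C(n - m - 1, n - k)%:Z)%R.

(** There are C(n - |S|, j) sets A with |A| = |S| + j containing S; with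
    r = k - |S| - 1 and M = n - k this is the preceding identity, the overall
    sign coming from k - |A| = (r - j) + 1. *)
Lemma sum_weight_supersets (n k : nat) (S : {set 'I_n}) :
  (#|S| < k)%N -> (k <= n)%N ->
  \sum_(A : {set 'I_n} | (S \subset A) && (#|A| < k)%N) weight n k #|A| = -1.
Proof.
move=> Sk kn; have [r k_eq] : exists r, (k = #|S| + r.+1)%N.
  by exists (k - #|S|.+1)%N; lia.
rewrite (partition_big (fun A : {set 'I_n} => inord (#|A| - #|S|) : 'I_r.+1) xpredT) //=.
rewrite -(alternating_binomial1 (n - k) r) -sumrN; apply: eq_bigr => j _.
rewrite (eq_bigl [in [set A : {set 'I_n} | (S \subset A) && (#|A| == #|S| + j)%N]]); last first.
  move=> A; rewrite inE; case SA: (S \subset A) => //=.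
  have cSA := subset_leq_card SA; have ltj := ltn_ord j.
  apply/andP/eqP => [[Ak /eqP/(congr1 val) /=]|cA]; last first.
    by rewrite cA addKn inord_val {1}k_eq ltn_add2l.
  rewrite inordK => [<-|]; first by rewrite subnKC.
  by rewrite -(ltn_add2l #|S|) subnKC // -k_eq.
rewrite (eq_bigr (fun=> weight n k (#|S| + j))); last first.
  by move=> A; rewrite inE => /andP[_ /eqP->].
rewrite sumr_const card_supersets card_ord /weight -mulr_natr.
have ltj := ltn_ord j.
have -> : (n - #|S| = (n - k).+1 + r)%N by lia.
have -> : (n - (#|S| + j) - 1 = n - k + (r - j))%N by lia.
have -> : (k - (#|S| + j) = (r - j).+1)%N by lia.
by rewrite exprS natrM; ring.
Qed.

(** * Partitions with at most one large block *)

Section OneBlock.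
Variable n : nat.
Implicit Types (A B : {set 'I_n}) (p q : set_partition n).

(** The fibres of a map that identifies the elements of A and separates all the
    others; for empty A this is the partition into singletons. *)
Definition one_block A : set_partition n :=
  SetPartition (preim_partitionP (fun x => if x \in A then None else Some x)
                                 [set: 'I_n]).

Lemma one_blockP A B :
  reflect (exists x, B = if x \in A then A else [set x]) (B \in blocks (one_block A)).
Proof.
have cell x : [set y in [set: 'I_n] | (if x \in A then None else Some x)
    == (if y \in A then None else Some y)] = if x \in A then A else [set x].
  apply/setP => y; rewrite !inE /=; case: ifP => xA; case: ifP => yA //=.
    by rewrite inE; apply/esym/negP => /eqP yx; rewrite -yx yA in xA.
  by rewrite inE eq_sym.
apply: (iffP imsetP) => [[x _ ->]|[x ->]]; by exists x.
Qed.

Lemma large_block_one_block A B :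
  B \in blocks (one_block A) -> (1 < #|B|)%N -> B = A.
Proof. by case/one_blockP => x ->; case: ifP => // _; rewrite cards1. Qed.

Lemma block_of p x : exists2 B, B \in blocks p & x \in B.
Proof.
case: p => P /= /and3P[/eqP covP _ _].
have : x \in cover P by rewrite covP inE.
by case/bigcupP => B; exists B.
Qed.

Lemma block_neq0 p B : B \in blocks p -> exists x, x \in B.
Proof.
case: p => P /= /and3P[_ _ P0] PB; apply/set0Pn.
by apply: contraNneq P0 => <-.
Qed.

Lemma small_set1 B x : (#|B| <= 1)%N -> x \in B -> B = [set x].
Proof. by move=> cB xB; apply/eqP; rewrite eq_sym eqEcard sub1set xB cards1. Qed.

Definition supp p : {set 'I_n} := cover [set B in blocks p | (1 < #|B|)%N].

(** Blocks with one element impose no condition, and the only block of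
    [one_block A] large enough to contain one with two elements is A. *)
Lemma le_one_block p A : (p <= one_block A)%O = (supp p \subset A).
Proof.
apply/refinesP/subsetP => [pA x /bigcupP[B]|sA B pB].
  rewrite inE => /andP[pB B1] xB; have [C qC BC] := pA B pB.
  have CA : C = A.
    by apply: large_block_one_block qC _; apply: leq_trans B1 (subset_leq_card BC).
  by rewrite -CA (subsetP BC).
have [x xB] := block_neq0 pB; exists (if x \in A then A else [set x]).
  by apply/one_blockP; exists x.
have [B1|B1] := ltnP 1 #|B|; last first.
  by rewrite (small_set1 B1 xB); case: ifP; rewrite sub1set ?inE.
have BA : B \subset A.
  by apply/subsetP => y yB; apply: sA; apply/bigcupP; exists B; rewrite ?inE ?pB.
by rewrite (subsetP BA _ xB).
Qed.

Lemma one_block_small A : (#|A| <= 1)%N -> one_block A = zero_partition n.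
Proof.
move=> cA; apply: val_inj; apply/setP => B.
apply/one_blockP/imsetP => [[x ->]|[x _ ->]]; exists x => //;
  by case: ifP => // xA; rewrite (small_set1 cA xA).
Qed.

(** For |A| <= 1 the block A, if any, is a singleton too: one partition is hit
    by n + 1 different sets. *)
Lemma one_block_eq0 A : (one_block A == zero_partition n) = (#|A| <= 1)%N.
Proof.
apply/eqP/idP => [A0|]; last exact: one_block_small.
have [//|A1] := leqP #|A| 1.
have [x xA] : exists x, x \in A by apply/card_gt0P; apply: ltnW.
have : A \in blocks (one_block A) by apply/one_blockP; exists x; rewrite xA.
by rewrite A0 => /imsetP[y _ Ay]; rewrite Ay cards1 in A1.
Qed.

Lemma le_one_partition p : (p <= one_partition n)%O.
Proof.
apply/refinesP => B pB; have [x xB] := block_neq0 pB.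
exists [set: 'I_n]; last exact: subsetT.
by rewrite !inE eqxx andbT; apply/set0Pn; exists x.
Qed.

Lemma supp_one_partition : (1 < n)%N -> supp (one_partition n) = [set: 'I_n].
Proof.
move=> n1; apply/eqP; rewrite eqEsubset subsetT; apply/subsetP => x _.
apply/bigcupP; exists [set: 'I_n]; rewrite // inE cardsT card_ord n1 andbT.
by rewrite one_partitionE ?inE // ltnW.
Qed.

(** * Membership in Lambda *)

Lemma big_sh p (P : pred nat) :
  (\sum_(a <- sh p | P a) a = \sum_(B in blocks p | P #|B|) #|B|)%N.
Proof.
by rewrite (perm_big _ (permEl (perm_sort _ _))) big_map big_enum_cond.
Qed.

(** A fibre of the grouping that adds up to 1 cannot contain a part of size at
    least 2, so all such parts lie in the fibre that adds up to k - 1. *)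
Lemma card_supp_Lambda k p : (0 < k)%N ->
  p \in Lambda k n -> p != one_partition n -> (#|supp p| < k)%N.
Proof.
move=> k0; rewrite inE => /orP[->//|/existsP[G /forallP GP]] _.
rewrite -(subnK k0) addn1 ltnS; apply: leq_trans (leq_card_cover _) _.
rewrite (eq_bigl (fun B => (B \in blocks p) && (1 < #|B|)%N)); last first.
  by move=> B; rewrite inE.
(* Compare part by part with the group of index 0, the one of sum k - 1. *)
rewrite -(big_sh p (fun a => 1 < a)%N) (big_nth 0%N) big_mkord.
rewrite -[X in (_ <= X)%N](eqP (GP ord0)) /=.
rewrite [X in (_ <= X)%N]big_mkcond [X in (X <= _)%N]big_mkcond.
apply: leq_sum => j _; case: ifP => // aj; case: ifP => // /negbT Gj.
move: (eqP (GP (G j))); rewrite (bigD1 j) //=.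
move: Gj; case: (G j) => [[|i]] //= i_lt Gj.
rewrite nth_nseq; move: aj; case: ifP => _; lia.
Qed.

Lemma sh_one_block A : (0 < #|A|)%N -> sh (one_block A) = #|A| :: nseq (n - #|A|) 1%N.
Proof.
move=> A0; rewrite -[RHS](@sorted_sort _ geq); first last.
- rewrite /= path_min_sorted; last by apply/allP => a /nseqP[->].
  by elim: (n - _)%N => //= m; case: m.
- by move=> a b c /= ba ac; apply: leq_trans ac ba.
apply/perm_sortP.
- by move=> a b /=; rewrite /geq /= leq_total.
- by move=> a b c /= ba ac; apply: leq_trans ac ba.
- by move=> a b /= ab; apply/eqP; rewrite eqn_leq andbC.
have blocksE : perm_eq (enum (blocks (one_block A))) (A :: [seq [set x] | x <- enum (~: A)]).
  apply: uniq_perm => [|/=|B]; first exact: enum_uniq.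
    rewrite map_inj_uniq ?enum_uniq ?andbT; last exact: set1_inj.
    apply/mapP => -[x]; rewrite mem_enum inE => xA Ax.
    by rewrite Ax set11 in xA.
  rewrite mem_enum inE; apply/one_blockP/orP => [[x ->]|].
    case: ifP => xA; [by left | right].
    by apply: map_f; rewrite mem_enum inE xA.
  case=> [/eqP->|/mapP[x]].
    by have /card_gt0P[x xA] := A0; exists x; rewrite xA.
  by rewrite mem_enum inE => /negbTE xA ->; exists x; rewrite xA.
apply: perm_trans (perm_map _ blocksE) _; rewrite /= -map_comp.
rewrite (@eq_map _ _ _ (fun=> 1%N)); last by move=> x /=; rewrite cards1.
rewrite perm_cons.
have -> : (n - #|A|)%N = size (enum (~: A)) by rewrite -cardE [RHS]cardsCs setCK card_ord.
by elim: (enum _) => //= x s; rewrite perm_cons.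
Qed.

(** The part m is completed to k - 1 by the first c = k - 1 - m parts equal to 1;
    each remaining part is a group by itself. *)
Lemma hook_le m k : (0 < m)%N -> (m < k)%N -> (k <= n)%N ->
  intpart_le (m :: nseq (n - m) 1%N) (k - 1 :: nseq (n - k + 1) 1)%N.
Proof.
move=> m0 mk kn; apply/existsP.
have [c c_def] : exists c, c = (k - 1 - m)%N by exists (k - 1 - m)%N.
have szb : size (k - 1 :: nseq (n - k + 1) 1)%N = (n - k + 1).+1 by rewrite /= size_nseq.
have sza : size (m :: nseq (n - m) 1)%N = (n - m).+1 by rewrite /= size_nseq.
exists [ffun j : 'I_(size (m :: nseq (n - m) 1%N)) => cast_ord (esym szb) (inord (j - c))].
apply/forallP => i; apply/eqP.
rewrite (eq_bigl (fun j : 'I_(size (m :: nseq (n - m) 1%N)) => j - c == i)%N); last first.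
  move=> j; rewrite ffunE -val_eqE /= inordK //.
  by have := ltn_ord j; rewrite [X in (_ < X)%N -> _]sza; 
     move: (nat_of_ord j); clear -m0 mk kn c_def; lia.
rewrite -(big_mkord (fun j => j - c == i)%N (nth 0%N (m :: nseq (n - m) 1%N))) sza.
rewrite big_mkcond big_nat_recl // -big_mkcond /= sub0n eq_sym.
rewrite big_nat_cond (eq_bigr (fun=> 1%N)) -?big_nat_cond; last first.
  by move=> j /andP[/andP[_ jm] _]; rewrite nth_nseq jm.
have := ltn_ord i; rewrite [X in (_ < X)%N -> _]szb.
(* The head m belongs to the group of index 0 only; the tail is all ones. *)
case: (nat_of_ord i) => [|i'] i_lt /=.
  rewrite (eq_bigl (fun j => true && (j < c))%N); last by move=> j; rewrite subn_eq0.
  rewrite -big_nat_widen; last by lia.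
  by rewrite sum_nat_const_nat; lia.
have lt_i : (i' + c < n - m)%N by move: i_lt; clear -m0 mk kn c_def; lia.
rewrite add0n nth_nseq -[(i' < _)%N]ltnS i_lt big_mkord (big_pred1 (Ordinal lt_i)) //.
by move=> j; rewrite [RHS]/= -[RHS]val_eqE [RHS]/=; move: (nat_of_ord j); clear; lia.
Qed.

(** The shape is a hook only when A is nonempty; the empty set gives the same
    partition as any singleton. *)
Lemma one_block_Lambda k A : (2 <= k)%N -> (k <= n)%N -> (#|A| < k)%N ->
  one_block A \in Lambda k n.
Proof.
move=> k2 kn; wlog A0 : A / (0 < #|A|)%N => [hA|Ak].
  have [A0|] := posnP #|A|; last exact: hA.
  have n0 : (0 < n)%N by apply: leq_trans kn; apply: leq_trans k2.
  have cx : #|[set Ordinal n0]| = 1%N by apply: cards1.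
  by rewrite one_block_small ?A0 // -(@one_block_small [set Ordinal n0]) ?cx // => _;
    apply: hA; rewrite cx.
by rewrite inE sh_one_block // hook_le ?orbT.
Qed.
End OneBlock.

(** * The Moebius function *)

(** Summing the right-hand side over all q >= p in Lambda leaves, besides the 1 at
    the top, the total weight of the small sets containing supp p: this is -1,
    except for p the top, where there are no such sets. *)
Lemma moebius_Lambda_one (n k : nat) (p : set_partition n) :
  (2 <= k)%N -> (k <= n)%N -> p \in Lambda k n ->
  moebius (Lambda k n) p (one_partition n) =
    (p == one_partition n)%:R +
    \sum_(A : {set 'I_n} | (#|A| < k)%N && (one_block A == p)) weight n k #|A|.
Proof.
move=> k2 kn pL; have oneL : one_partition n \in Lambda k n by rewrite inE eqxx.
pose g (q : set_partition n) : int := (q == one_partition n)%:R +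
  \sum_(A : {set 'I_n} | (#|A| < k)%N && (one_block A == q)) weight n k #|A|.
apply: (moebius_uniq_above (g := g) oneL _ pL (le_one_partition p)).
move=> {pL}p pL _; rewrite /g.
rewrite big_split /= (bigD1 (one_partition n)) ?oneL ?le_one_partition ?lexx //=.
rewrite eqxx big1 => [|q /andP[_ /negbTE->]] //; rewrite addr0.
(* Each A contributes once, at q = one_block A, provided p <= one_block A. *)
rewrite (exchange_big_dep (fun A : {set 'I_n} => #|A| < k)%N) /=; last by move=> q A _ /andP[].
rewrite (eq_bigr (fun A : {set 'I_n} => if supp p \subset A then weight n k #|A| else 0));
    last first.
  move=> A Ak; rewrite -le_one_block; case: ifP => pA.
    rewrite (big_pred1 (one_block A)) // => q; rewrite Ak /= [RHS]eq_sym.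
    case: eqP => [<-|]; last by rewrite andbF.
    by rewrite one_block_Lambda // pA le_one_partition.
  rewrite big_pred0 // => q; rewrite Ak /=; case: eqP => [<-|]; last by rewrite andbF.
  by rewrite pA andbF.
rewrite -big_mkcondr /=; case: eqVneq => [->|p1].
  rewrite big_pred0 ?addr0 // => A; rewrite supp_one_partition; last exact: leq_trans kn.
  apply/negP => /andP[Ak /subset_leq_card]; rewrite cardsT card_ord leqNgt => /negP[].
  exact: leq_trans kn.
rewrite (eq_bigl (fun A : {set 'I_n} => (supp p \subset A) && (#|A| < k)%N)); last first.
  by move=> A; rewrite andbC.
by rewrite sum_weight_supersets ?subrr // card_supp_Lambda // ltnW.
Qed.

(** * Reading off the values *)

Lemma one_block_of_unique_large_block (n : nat) (p : set_partition n) (A : {set 'I_n}) :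
  A \in blocks p -> (forall B, B \in blocks p -> B != A -> (#|B| <= 1)%N) ->
  one_block A = p.
Proof.
move=> pA small; apply: le_anti; apply/andP; split; last first.
  rewrite le_one_block; apply/subsetP => x /bigcupP[B].
  rewrite inE ltnNge => /andP[pB B1] xB.
  by have [<-//|BA] := eqVneq B A; rewrite small in B1.
apply/refinesP => B /one_blockP[x ->]; case: ifP => _; first by exists A.
by have [C pC xC] := block_of p x; exists C; rewrite ?sub1set.
Qed.

Lemma zero_partition_neq_one (n : nat) :
  (1 < n)%N -> zero_partition n != one_partition n.
Proof.
move=> n1; apply/eqP => z1.
have : [set: 'I_n] \in blocks (one_partition n).
  by rewrite one_partitionE ?inE // ltnW.
rewrite -z1 => /imsetP[x _ /(congr1 (fun B : {set 'I_n} => #|B|))].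
by rewrite cardsT card_ord cards1 => n_eq; rewrite n_eq in n1.
Qed.

Lemma sum_small_sets (T : finType) (f : nat -> int) :
  \sum_(A : {set T} | (#|A| <= 1)%N) f #|A| = f 0%N + #|T|%:Z * f 1%N.
Proof.
rewrite (bigID (fun A : {set T} => #|A| == 0%N)) /=; congr (_ + _).
  rewrite (big_pred1 set0) ?cards0 // => A.
  by rewrite cards_eq0 andb_idl // => /eqP->; rewrite cards0.
rewrite (eq_bigl [in [set A : {set T} | #|A| == 1%N]]); last first.
  by move=> A; rewrite inE; case: #|A| => [|[]].
rewrite (eq_bigr (fun=> f 1%N)); last by move=> A; rewrite inE => /eqP->.
by rewrite sumr_const card_draws bin1 -mulr_natl natz.
Qed.

(* F lists the blocks of p by weakly decreasing size; |F_1| and |F_2| are f1 and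
   f2, and f2 = 0 when p has a single block. *)
Theorem theorem4p3 (k n : nat) (hk : (2 <= k)%N) (hkn : (k <= n)%N)
    (p : set_partition n) (hp : p \in Lambda k n)
    (F : seq {set 'I_n}) (F_uniq : uniq F) (F_blocks : F =i blocks p)
    (F_sorted : sorted geq [seq #|B| | B : {set 'I_n} <- F]) :
  let mu := moebius (Lambda k n) p (one_partition n) in
  let f1 := #|nth set0 F 0| in
  let f2 := #|nth set0 F 1| in
  [/\ p = one_partition n -> mu = 1,
      (2 <= f2)%N -> mu = 0,
      f2 = 1%N -> (2 <= f1 <= k - 1)%N ->
        mu = (-1) ^+ (k - f1) * 'C(n - f1 - 1, n - k)%:Z
    & p = zero_partition n ->
        mu = (-1) ^+ k * ('C(n - 1, n - k)%:Z - n%:Z * 'C(n - 2, n - k)%:Z)].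
Proof.
move=> mu f1 f2.
have muE : mu = _ := moebius_Lambda_one hk hkn hp.
have n1 : (1 < n)%N := leq_trans hk hkn.
(* A positive f2 excludes the default value of nth: F has two entries. *)
have two_blocks : (0 < f2)%N ->
    [/\ nth set0 F 0 \in blocks p, nth set0 F 1 \in blocks p & nth set0 F 0 != nth set0 F 1].
  move=> f2_gt0; have szF : (1 < size F)%N.
    by rewrite ltnNge; apply: contraL f2_gt0 => /(nth_default set0) F1; rewrite /f2 F1 cards0.
  by rewrite -!F_blocks !mem_nth ?nth_uniq // ltnW.
have size_le i j : (i <= j)%N -> (#|nth set0 F j| <= #|nth set0 F i|)%N.
  move=> ij; have [jF|Fj] := ltnP j (size F); last by rewrite (nth_default _ Fj) cards0.
  have geq_trans : transitive geq by move=> a b c /= ba ac; apply: leq_trans ac ba.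
  have := sorted_leq_nth geq_trans leqnn 0%N F_sorted.
  move/(_ i j); rewrite !inE size_map !(nth_map set0) ?(leq_ltn_trans ij) //.
  by apply.
have p_neq1 : (0 < f2)%N -> p != one_partition n.
  case/two_blocks => F0 F1; apply: contraNneq => p1.
  by move: F0 F1; rewrite p1 one_partitionE ?inE ?(ltnW n1) // => /eqP-> /eqP->.
split.
- by move=> p1; rewrite /mu moebiusE p1 eqxx.
- move=> f2_ge2; have f2_gt0 := ltnW f2_ge2.
  rewrite muE (negbTE (p_neq1 f2_gt0)) add0r big_pred0 // => A.
  apply/negP => /andP[_ /eqP Ap]; have [F0 F1 /eqP[]] := two_blocks f2_gt0.
  rewrite -Ap in F0 F1; have f1_ge2 := leq_trans f2_ge2 (size_le 0%N 1%N isT).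
  by rewrite (large_block_one_block F0 f1_ge2) (large_block_one_block F1 f2_ge2).
- move=> f2_1 /andP[f1_ge2 f1_le].
  have f2_gt0 : (0 < f2)%N by rewrite f2_1.
  have [F0 _ _] := two_blocks f2_gt0.
  have F0p : one_block (nth set0 F 0) = p.
    apply: one_block_of_unique_large_block F0 _ => B.
    rewrite -F_blocks => /(nthP set0)[[|i] _ <-].
      by rewrite eqxx.
    by move=> _; rewrite -f2_1; apply: size_le.
  rewrite muE (negbTE (p_neq1 f2_gt0)) add0r (big_pred1 (nth set0 F 0)) // => A.
  apply/andP/eqP => [[_ /eqP Ap]|->].
    by rewrite -Ap in F0; rewrite (large_block_one_block F0 f1_ge2).
  by rewrite F0p eqxx; split=> //; rewrite -/f1; lia.
- move=> p0; (* The term |A| = 0 gives C(n - 1, n - k), the n sets with |A| = 1 the rest. *)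
  rewrite muE p0 (negbTE (zero_partition_neq_one n1)) add0r.
  rewrite (eq_bigl (fun A : {set 'I_n} => #|A| <= 1)%N); last first.
    by move=> A; rewrite one_block_eq0 andb_idl // => A1; apply: leq_ltn_trans A1 hk.
  rewrite (sum_small_sets _ (weight n k)) card_ord /weight subn0 subn0 -subnDA.
  have [k' ->] : exists k', k = k'.+1 by exists k.-1; lia.
  by rewrite addn1 (subn1 k'.+1) exprS /=; ring.
Qed.
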